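(* Let $\mathcal{F}_1,\ldots,\mathcal{F}_{d+1}$ be finite families of pointed affine semigroups in $\mathbb{Z}^d$. If for every choice of a transversal $S_1 \in \mathcal{F}_1$, $S_2 \in \mathcal{F}_2$, $\ldots$, $S_{d+1} \in \mathcal{F}_{d+1}$, the intersection $S_1 \cap \cdots \cap S_{d+1}$ contains a non-zero element, then there is a family $\mathcal{F}_j$ such that all semigroups in $\mathcal{F}_j$ intersect at a (common) non-zero element.
   Context: An affine semigroup in $\mathbb{Z}^d$ is a set of the form $\operatorname{Sg}(A) = \{Ax : x \in \mathbb{Z}^n,\ x \ge 0\}$ for some integer matrix $A \in \mathbb{Z}^{d\times n}$. It is pointed if it contains no nontrivial subgroup; equivalently, the cone $\{Ax : x \in \mathbb{R}^n,\ x\ge 0\}$ contains no positive-dimensional linear subspace. *)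

(* Defs.v *)
From mathcomp Require Import all_boot all_order all_algebra.
From mathcomp Require Import all_classical.

Set Implicit Arguments.
Unset Strict Implicit.
Unset Printing Implicit Defensive.

Import GRing.Theory Num.Theory.

Local Open Scope classical_set_scope.
Local Open Scope ring_scope.

Definition Sg (d n : nat) (A : 'M[int]_(d, n)) : set 'cV[int]_d :=
  [set A *m x | x in [set x : 'cV[int]_n | forall i, 0 <= x i 0]].

Definition affine_semigroup (d : nat) (S : set 'cV[int]_d) : Prop :=
  exists (n : nat) (A : 'M[int]_(d, n)), S = Sg A.

(* H ranges over all subgroups of Z^d: classically, every subset of Z^d is the
   extension of a boolean predicate, which is what [zmod_closed] is about. *)
Definition pointed (d : nat) (S : set 'cV[int]_d) : Prop :=
  forall H : {pred 'cV[int]_d},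
    zmod_closed H -> [set` H] `<=` S -> [set` H] = [set 0].

(* Main.v *)
Require Import Defs.
From mathcomp Require Import all_boot all_order all_algebra.
From mathcomp Require Import all_classical.
From mathcomp Require Import lra.

(** Clearing denominators turns the statement into one about convex sets. For
a submonoid [S] of Z^d, the nonzero rational points having a positive multiple
in [S] form a set that is convex when [S] is pointed
([convex_rational_cone_nonzero]): a vanishing convex combination would put
some nonzero [x] and its opposite in the cone of [S]. Finitely many semigroups
share a nonzero element iff the corresponding convex sets of Q^d meet, so the
statement is the colourful Helly theorem ([colorful_helly]) over the ordered
field Q.

The colourful Helly theorem is proved by Lovasz's extremal argument. The convex
sets are shrunk to polytopes, the hulls of points chosen in the transversal
intersections. A linear form [c] attains its minimum on each intersection of
polytopes, at one of finitely many points that do not depend on [c]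
([hulls_min]), so [c] can be chosen injective on these points
([separating_functional]). Among all ways to omit a colour [k] and to pick one
polytope of each other colour, take one whose intersection has the highest
minimum, at [p] say. Adding a polytope [K] of colour [k] gives a full
transversal, whose minimizer [q] satisfies [c p <= c q]. If the inequality were
strict, then, by maximality, each subfamily of the transversal obtained by
omitting one polytope would meet the open half-space [c z < c q]; Helly's
theorem for [d + 2] convex sets ([helly]) would give a point of the whole
transversal below its minimum. Hence [c p = c q], so that [p = q] lies in [K],
and [K] was an arbitrary member of colour [k].

Since Q is not complete, the minima come from linear programming and not from
compactness: a feasible point of smallest support, among those that are at
least as good as a given one, is determined by its support
([finite_vertices]). *)

Set Implicit Arguments.
Unset Strict Implicit.
Unset Printing Implicit Defensive.

Import Order.TTheory GRing.Theory Num.Theory.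

Local Open Scope classical_set_scope.
Local Open Scope ring_scope.

(** * Convex sets and Helly's theorem *)

Section Convexity.
Variables (R : realFieldType) (d : nat).
Local Notation V := 'cV[R]_d.

(** Convex combinations of arbitrary length, rather than of two points, let
Radon partitions and hulls be used without an induction. Points of zero weight
are unconstrained, so that a combination can be restricted to the support of
its weights without reindexing. *)
Definition convex (K : set V) : Prop :=
  forall (I : finType) (a : I -> R) (z : I -> V),
    (forall i, 0 <= a i) -> \sum_i a i = 1 ->
    (forall i, a i != 0 -> K (z i)) -> K (\sum_i a i *: z i).

(** The vectors [(1, z i)] are [d + 2] vectors in dimension [d + 1]. *)
Lemma radon (z : 'I_d.+2 -> V) :
  exists a : 'I_d.+2 -> R,
    [/\ exists i, a i != 0, \sum_i a i = 0 & \sum_i a i *: z i = 0].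
Proof.
pose M : 'M[R]_(d.+2, 1 + d) := \matrix_i row_mx 1%:M (z i)^T.
have kerM : kermx M != 0.
  rewrite -mxrank_eq0 mxrank_ker subn_eq0 -ltnNge ltnS.
  exact: rank_leq_col.
have /rowV0Pn[v vM v0] := kerM.
have {vM} : v *m M = 0 by apply/sub_kermxP.
rewrite mulmx_sum_row => vM.
have vM' : \sum_i v 0 i *: row_mx (1%:M : 'M_1) (z i)^T = 0.
  by rewrite -[RHS]vM; apply: eq_bigr => i _; rewrite rowK.
exists (v 0); split.
- by have /rV0Pn[i vi] := v0; exists i.
- have /(congr1 lsubmx) := vM'.
  rewrite linear0 linear_sum => /matrixP/(_ 0 0); rewrite mxE summxE => h.
  rewrite -[RHS]h; apply: eq_bigr => i _.
  by rewrite linearZ /= row_mxKl !mxE mulr1.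
- have /(congr1 rsubmx)/(congr1 trmx) := vM'.
  rewrite !linear0 !linear_sum => h.
  rewrite -[RHS]h; apply: eq_bigr => i _.
  by rewrite linearZ /= row_mxKr linearZ /= trmxK.
Qed.

(** Let [z k] lie in every set but [C k]. The positive and the negative part of
an affine dependence between the [z k] write one and the same point as a convex
combination in two ways, with disjoint supports. An index [i] is missing from
one of the two supports, and the combination with that support stays in
[C i]. *)
Lemma helly (C : 'I_d.+2 -> set V) :
  (forall i, convex (C i)) ->
  (forall k, exists z, forall i, i != k -> C i z) ->
  exists z, forall i, C i z.
Proof.
move=> Ccvx /choice[z zC].
have [a [[i0 ai0] sum_a sum_az]] := radon z.
pose p i := Num.max (a i) 0; pose n i := Num.max (- a i) 0.
have aE i : a i = p i - n i.
  by rewrite /p /n; case: (lerP (a i) 0); case: (lerP (- a i) 0); lra.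
have p_ge0 i : 0 <= p i by rewrite /p le_max lexx orbT.
have n_ge0 i : 0 <= n i by rewrite /n le_max lexx orbT.
have sum_pn : \sum_i p i = \sum_i n i.
  apply/eqP; rewrite -subr_eq0 -sumrB -[X in _ == X]sum_a.
  by apply/eqP/eq_bigr.
have sum_pnz : \sum_i p i *: z i = \sum_i n i *: z i.
  apply/eqP; rewrite -subr_eq0 -sumrB -[X in _ == X]sum_az.
  by apply/eqP/eq_bigr => i _; rewrite -scalerBl -aE.
have s_gt0 : 0 < \sum_i p i.
  rewrite lt_def sumr_ge0 // andbT; apply: contra ai0 => /eqP s0.
  have := sum_pn; rewrite s0 => /esym n0.
  have pi0 : p i0 = 0 by apply: (psumr_eq0P _ s0).
  have ni0 : n i0 = 0 by apply: (psumr_eq0P _ n0).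
  by rewrite aE pi0 ni0 subrr.
set s := \sum_i p i in s_gt0 sum_pn.
have cvx_comb (q : 'I_d.+2 -> R) i : (forall k, 0 <= q k) -> \sum_k q k = s ->
    (forall k, q k != 0 -> i != k) -> C i (s^-1 *: \sum_k q k *: z k).
  move=> q_ge0 sum_q qi; rewrite scaler_sumr.
  under eq_bigr do rewrite scalerA.
  apply: Ccvx => [k||k].
  - by rewrite mulr_ge0 // invr_ge0 ltW.
  - by rewrite -mulr_sumr sum_q mulVf // gt_eqF.
  - by rewrite mulf_eq0 negb_or => /andP[_ /qi]; apply: zC.
exists (s^-1 *: \sum_i p i *: z i) => i.
have [ai_gt0|ai_le0] := ltrP 0 (a i).
- rewrite sum_pnz; apply: cvx_comb => // k; apply: contra => /eqP <-.
  by rewrite /n; apply/eqP/max_idPr; lra.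
- apply: cvx_comb => // k; apply: contra => /eqP <-.
  by rewrite /p; apply/eqP/max_idPr; lra.
Qed.

(** * Polytopes and linear forms *)

Definition weights (T : finType) (P : pred T) (w : T -> R) : Prop :=
  [/\ forall t, 0 <= w t, \sum_t w t = 1 & forall t, ~~ P t -> w t = 0].

Definition hull (T : finType) (x : T -> V) (P : pred T) : set V :=
  [set \sum_t w t *: x t | w in weights P].

Lemma sub_hull (T : finType) (x : T -> V) (P : pred T) t : P t -> hull x P (x t).
Proof.
move=> Pt; exists (fun u => (u == t)%:R); first split=> [u||u].
- exact: ler0n.
- by rewrite (bigD1 t) //= eqxx big1 ?addr0 // => u /negPf ->.
- by move=> Pu; case: eqP => // ut; rewrite ut Pt in Pu.
- rewrite (bigD1 t) //= eqxx scale1r big1 ?addr0 // => u /negPf ->.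
  by rewrite scale0r.
Qed.

Lemma hull_subset_convex (T : finType) (x : T -> V) (P : pred T) (K : set V) :
  convex K -> (forall t, P t -> K (x t)) -> hull x P `<=` K.
Proof.
move=> Kcvx PK _ [w [w0 w1 wP] <-]; apply: Kcvx => // t wt.
by apply: PK; apply: contraNT wt => /wP ->.
Qed.

Lemma convex_hull (T : finType) (x : T -> V) (P : pred T) : convex (hull x P).
Proof.
move=> I a z a_ge0 sum_a zP.
have /choice[w wP] : forall i, exists w : T -> R,
    a i != 0 -> weights P w /\ \sum_t w t *: x t = z i.
  move=> i; have [_|/zP[w ? ?]] := eqVneq (a i) 0; first by exists (fun=> 0).
  by exists w.
exists (fun t => \sum_i a i * w i t); first split=> [t||t Pt].
- apply: sumr_ge0 => i _; have [->|ai] := eqVneq (a i) 0; first by rewrite mul0r.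
  by have [[? _ _] _] := wP i ai; rewrite mulr_ge0.
- rewrite exchange_big -[RHS]sum_a; apply: eq_bigr => i _ /=.
  have [->|ai] := eqVneq (a i) 0; first by rewrite big1 // => ?; rewrite mul0r.
  by have [[_ w1 _] _] := wP i ai; rewrite -mulr_sumr w1 mulr1.
- rewrite big1 // => i _; have [->|ai] := eqVneq (a i) 0; first by rewrite mul0r.
  by have [[_ _ w0] _] := wP i ai; rewrite w0 ?mulr0.
- under eq_bigr do rewrite scaler_suml.
  rewrite exchange_big; apply: eq_bigr => i _ /=.
  have [->|ai] := eqVneq (a i) 0.
    by rewrite scale0r big1 // => ?; rewrite mul0r scale0r.
  have [_ <-] := wP i ai; rewrite scaler_sumr.
  by apply: eq_bigr => t _; rewrite scalerA.
Qed.

Definition dotp (c : 'rV[R]_d) (z : V) : R := (c *m z) 0 0.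

Lemma dotp_sum (c : 'rV[R]_d) (I : finType) (a : I -> R) (z : I -> V) :
  dotp c (\sum_i a i *: z i) = \sum_i a i * dotp c (z i).
Proof.
rewrite /dotp mulmx_sumr summxE; apply: eq_bigr => i _.
by rewrite -scalemxAr mxE.
Qed.

Lemma convex_halfspace (c : 'rV[R]_d) (r : R) : convex [set z | dotp c z < r].
Proof.
move=> I a z a_ge0 sum_a zr /=; rewrite dotp_sum -subr_gt0.
have -> : r - \sum_i a i * dotp c (z i) = \sum_i a i * (r - dotp c (z i)).
  under [RHS]eq_bigr do rewrite mulrBr.
  by rewrite sumrB -mulr_suml sum_a mul1r.
have term_ge0 i : 0 <= a i * (r - dotp c (z i)).
  have [->|/zr/= zir] := eqVneq (a i) 0; first by rewrite mul0r.
  by rewrite mulr_ge0 // subr_ge0 ltW.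
rewrite lt_def sumr_ge0 // andbT; apply/eqP => /psumr_eq0P a0.
have : \sum_i a i = 0.
  rewrite big1 // => i _; apply/eqP; apply: contraT => ai.
  have /eqP : a i * (r - dotp c (z i)) = 0 by apply: a0.
  by rewrite mulf_eq0 (negPf ai) subr_eq0 gt_eqF //; apply: zr.
by rewrite sum_a => /eqP; rewrite oner_eq0.
Qed.

(** Take [c] on the moment curve, [c = (1, t, t^2, ...)]. For [v != 0] the
value of [c] at [v] is a nonzero polynomial in [t], hence some [t] avoids the
roots for all nonzero differences [v] of points of [s]. *)
Lemma separating_functional (s : seq V) :
  exists c : 'rV[R]_d, {in s &, injective (dotp c)}.
Proof.
pose p := \prod_(v <- [seq u.1 - u.2 | u <- [seq (x, y) | x <- s, y <- s]]
             | v != 0) rVpoly v^T.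
have p0 : p != 0.
  rewrite /p prodf_seq_neq0; apply/allP => v _; apply/implyP; apply: contra.
  move=> /eqP/(congr1 (@poly_rV _ d)); rewrite rVpolyK linear0 => vT.
  by rewrite -[v]trmxK vT trmx0.
pose rs : seq R := [seq i%:R | i <- iota 0 (size p)].
have /allPn[t _ pt] : ~~ all (root p) rs.
  apply: contraL (leqnn (size p)) => /(max_poly_roots p0).
  rewrite -ltnNge size_map size_iota; apply.
  by rewrite map_inj_uniq ?iota_uniq //; apply: mulrIn; rewrite oner_eq0.
exists (\row_k t ^+ k) => x y xs ys xy.
apply/eqP; rewrite -subr_eq0; apply: contraNT pt => xy0.
have -> : p = rVpoly (x - y)^T * (p %/ rVpoly (x - y)^T).
  rewrite mulrC divpK // /p (big_rem (x - y)) /=; last first.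
    by apply: (map_f (fun u => u.1 - u.2)) (allpairs_f pair xs ys).
  by rewrite xy0 dvdp_mulr.
rewrite rootM; apply/orP; left; rewrite /root (horner_coef_wide _ (size_poly _ _)).
under eq_bigr do rewrite coef_rVpoly_ord !mxE mulrBl.
rewrite sumrB subr_eq0; apply/eqP.
move: xy; rewrite /dotp !mxE.
under eq_bigr do rewrite mxE mulrC.
by under [X in _ = X -> _]eq_bigr do rewrite mxE mulrC.
Qed.
End Convexity.

(** * Attained minima *)

Section Minimum.
Variables (R : realFieldType).

Lemma seq_min (T : eqType) (s : seq T) (P : set T) (g : T -> R) :
  (exists2 x, x \in s & P x) ->
  exists x, [/\ x \in s, P x & forall y, y \in s -> P y -> g x <= g y].
Proof.
move=> [x0 x0s Px0].
have i0_lt : (index x0 s < size s)%N by rewrite index_mem.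
pose Q (i : 'I_(size s)) := `[< P (nth x0 s i) >].
have Qi0 : Q (Ordinal i0_lt) by apply/asboolP; rewrite nth_index.
have [i /asboolP Pi imin] := @arg_minP _ _ _ _ Q (fun i => g (nth x0 s i)) Qi0.
exists (nth x0 s i); split=> // [|y ys Py]; first exact: mem_nth.
have iy_lt : (index y s < size s)%N by rewrite index_mem.
have := imin (Ordinal iy_lt); rewrite /= nth_index //; apply.
by apply/asboolP; rewrite nth_index.
Qed.

Definition line (I : finType) (t : R) (y y' : {ffun I -> R}) : {ffun I -> R} :=
  [ffun i => y i + t * (y' i - y i)].

(** [E] plays the part of the solution set of a system of linear equations. The
antichain condition says that no nonzero direction of [E] has all its
coordinates nonnegative, which keeps the nonnegative solutions bounded. *)
Section Vertices.
Variables (I : finType) (E : set {ffun I -> R}).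
Hypothesis E_affine :
  forall t y y', E y -> E y' -> E (line t y y').
Hypothesis E_antichain :
  forall y y', E y -> E y' -> (forall i, y i <= y' i) -> y = y'.

Let feasible : set {ffun I -> R} := [set y | E y /\ forall i, 0 <= y i].
Let supp (y : {ffun I -> R}) := [set i | y i != 0]%SET.

(** Move from [v] straight away from [u], until the first coordinate vanishes.
Coordinates outside the common support stay zero, and some coordinate does
decrease because [u] is not below [v]. *)
Lemma smaller_support (u v : {ffun I -> R}) :
  feasible u -> feasible v -> u != v -> supp u = supp v ->
  exists t, [/\ 0 <= t, feasible (line (- t) v u) &
    (#|supp (line (- t) v u)| < #|supp v|)%N].
Proof.
move=> [Eu u0] [Ev v0] uv suv.
have [i0 vui0] : exists i, v i < u i.
  apply: contrapT => /forallNP vu; move/eqP: uv; apply.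
  by apply: E_antichain => // i; have /negP := vu i; rewrite -leNgt.
pose ratio i := v i / (u i - v i).
have [i vui imin] := @arg_minP _ _ _ i0 (fun i => v i < u i) ratio vui0.
have wE k : line (- ratio i) v u k = v k - ratio i * (u k - v k).
  by rewrite ffunE mulNr.
have ratio_ge0 : 0 <= ratio i.
  by rewrite divr_ge0 // subr_ge0 ltW.
exists (ratio i); split=> //.
- split=> [|k]; first exact: E_affine.
  rewrite wE subr_ge0; have [vuk|uvk] := ltrP (v k) (u k).
    by rewrite -ler_pdivlMr ?subr_gt0 //; apply: imin.
  by apply: le_trans (v0 k); rewrite mulr_ge0_le0 // subr_le0.
- apply: proper_card; apply/properP; split.
    apply/fintype.subsetP => k; rewrite !inE wE; apply: contra => /eqP vk.
    have : k \notin supp u by rewrite suv inE vk eqxx.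
    by rewrite inE negbK => /eqP ->; rewrite vk subrr mulr0 subrr.
  exists i; rewrite !inE.
    have : i \in supp u by rewrite inE gt_eqF // (le_lt_trans (v0 i)).
    by rewrite suv inE.
  by rewrite wE /ratio divfK ?subrr ?eqxx // gt_eqF // subr_gt0.
Qed.

(** Pick one feasible point for each support. Below a given feasible point,
take a feasible [b] with the smallest support. Were [b] not the point picked for
its support, moving along the line through both, away from the one with the
larger cost, would give a feasible point that is at least as good and has a
smaller support. *)
Lemma finite_vertices :
  exists B : seq {ffun I -> R},
    forall c : {ffun I -> R} -> R,
      (forall t y y', c (line t y y') = c y + t * (c y' - c y)) ->
      forall y, feasible y -> exists2 b, b \in B & feasible b /\ c b <= c y.
Proof.
have /choice[vertex vertexP] : forall s : {set I}, exists b,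
    (exists y, feasible y /\ supp y = s) -> feasible b /\ supp b = s.
  move=> s; have [[y yP]|] := pselect (exists y, feasible y /\ supp y = s).
    by exists y.
  by exists [ffun=> 0].
exists [seq vertex s | s <- enum {: {set I}}] => c c_affine y y_feas.
pose below n := `[< exists b, [/\ feasible b, c b <= c y & #|supp b| = n] >].
have below_ex : exists n, below n.
  by exists #|supp y|; apply/asboolP; exists y.
have [n /asboolP[b [b_feas cb bn]] nmin] := ex_minnP below_ex.
have no_smaller w : feasible w -> c w <= c y -> ~ (#|supp w| < n)%N.
  move=> w_feas cw; apply/negP; rewrite -leqNgt; apply: nmin.
  by apply/asboolP; exists w.
have [v_feas suppv] := vertexP (supp b) (ex_intro _ b (conj b_feas erefl)).
have no_improvement u v : feasible u -> feasible v -> supp u = supp v ->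
    #|supp v| = n -> c v <= c u -> c v <= c y -> u = v.
  move=> u_feas v_feas' suv vn cvu cvy; apply/eqP; apply: contraT => uv.
  have [t [t_ge0 w_feas]] := smaller_support u_feas v_feas' uv suv.
  rewrite vn => w_small; case: (no_smaller _ w_feas _ w_small).
  rewrite c_affine; apply: le_trans cvy; rewrite -lerBrDl subrr.
  by rewrite mulNr oppr_le0 mulr_ge0 // subr_ge0.
exists (vertex (supp b)); first by apply/map_f; rewrite mem_enum.
split=> //; have [cbv|/ltW cvb] := lerP (c b) (c (vertex (supp b))).
  by have -> : vertex (supp b) = b by apply: no_improvement.
by apply: le_trans cb.
Qed.
End Vertices.

Variable d : nat.
Local Notation V := 'cV[R]_d.

(** A point of the intersection is described by the families of weights that
represent it in each hull; they are the nonnegative solutions of a linear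
system, and the equations that fix the total weights make them an
antichain. *)
Lemma hulls_min (A T : finType) (a0 : A) (P : A -> pred T) (x : T -> V) :
  exists B : seq V, forall c : 'rV[R]_d,
    (exists z, forall a, hull x (P a) z) ->
    exists b, [/\ b \in B, forall a, hull x (P a) b &
      forall z, (forall a, hull x (P a) z) -> dotp c b <= dotp c z].
Proof.
pose mass a (y : {ffun A * T -> R}) := \sum_t y (a, t).
pose point a (y : {ffun A * T -> R}) : V := \sum_t y (a, t) *: x t.
have massE a t y y' :
    mass a (line t y y') = mass a y + t * (mass a y' - mass a y).
  rewrite /mass -sumrB mulr_sumr -big_split; apply: eq_bigr => u _ /=.
  by rewrite ffunE.
have pointE a t y y' :
    point a (line t y y') = point a y + t *: (point a y' - point a y).
  rewrite /point -sumrB scaler_sumr -big_split; apply: eq_bigr => u _ /=.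
  by rewrite ffunE scalerDl -scalerBl scalerA.
pose E : set {ffun A * T -> R} := [set y | forall a,
  [/\ mass a y = 1, forall t, ~~ P a t -> y (a, t) = 0 & point a y = point a0 y]].
have [||B BP] := @finite_vertices _ E.
- move=> t y y' Ey Ey' a.
  have [m1 s1 p1] := Ey a; have [m2 s2 p2] := Ey' a; split=> [|u Pu|].
  + by rewrite massE m1 m2 subrr mulr0 addr0.
  + by rewrite ffunE s1 // s2 // subrr mulr0 addr0.
  + by rewrite !pointE p1 p2.
- move=> y y' Ey Ey' yy'; apply/ffunP => -[a t].
  have [m1 _ _] := Ey a; have [m2 _ _] := Ey' a.
  have /eqP : \sum_u (y' (a, u) - y (a, u)) = 0.
    by rewrite sumrB -/(mass a y') -/(mass a y) m1 m2 subrr.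
  rewrite psumr_eq0 => [/allP/(_ t)|u _]; last by rewrite subr_ge0.
  by rewrite mem_index_enum subr_eq0 => /(_ isT)/eqP ->.
have feasP z : (forall a, hull x (P a) z) <->
    exists2 y, E y /\ (forall i, 0 <= y i) & point a0 y = z.
  split=> [zP|[y [Ey y0] <-] a]; last first.
    by have [m s <-] := Ey a; exists (fun t => y (a, t)).
  have /choice[w wP] : forall a, exists w,
      weights (P a) w /\ \sum_t w t *: x t = z.
    by move=> a; have [w] := zP a; exists w.
  have pw a : point a [ffun i => w i.1 i.2] = z.
    by have [_ <-] := wP a; apply: eq_bigr => t _; rewrite ffunE.
  exists [ffun i => w i.1 i.2] => //; split=> [a|[a t]]; last first.
    by rewrite ffunE; have [[]] := wP a.
  have [[w0 w1 wP'] _] := wP a; split=> [|t Pt|]; rewrite ?pw //.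
    by rewrite -[RHS]w1; apply: eq_bigr => t _; rewrite ffunE.
  by rewrite ffunE wP'.
exists [seq point a0 y | y <- B] => c [z0 z0P].
have dotpE t y y' : dotp c (point a0 (line t y y')) =
    dotp c (point a0 y) + t * (dotp c (point a0 y') - dotp c (point a0 y)).
  by rewrite pointE /dotp mulmxDr -scalemxAr mulmxBr !mxE.
have vertex_below z : (forall a, hull x (P a) z) -> exists b,
    [/\ b \in [seq point a0 y | y <- B], (forall a, hull x (P a) b) &
        dotp c b <= dotp c z].
  move=> /feasP[y y_feas <-].
  have [b bB [b_feas cb]] := BP (fun y => dotp c (point a0 y)) dotpE y y_feas.
  exists (point a0 b); split=> //; first exact: map_f.
  by apply/feasP; exists b.
have [b0 [b0B b0P _]] := vertex_below _ z0P.
have [b [bB bP bmin]] := seq_min (dotp c)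
  (ex_intro2 _ (fun z => forall a, hull x (P a) z) _ b0B b0P).
exists b; split=> // z /vertex_below[b' [b'B b'P]].
by apply: le_trans; apply: bmin.
Qed.
End Minimum.

(** * The colourful Helly theorem *)

Section ColorfulHelly.
Variables (R : realFieldType) (d : nat).
Local Notation V := 'cV[R]_d.

(** All colours are indexed by the same type [J]; families of different sizes
are covered by letting [K i] repeat members. *)
Theorem colorful_helly (J : finType) (K : 'I_d.+1 -> J -> set V) :
  (forall i j, convex (K i j)) ->
  (forall f : 'I_d.+1 -> J, exists z, forall i, K i (f i) z) ->
  exists i z, forall j, K i j z.
Proof.
move=> Kcvx Kmeet.
(* For [d = 0] there is one colour and one point; the extremal argument needs at
   least one colour besides the omitted one. *)
have [d0|d_gt0] := posnP d.
  exists 0, 0 => j; have [z /(_ 0)] := Kmeet (fun=> j).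
  have -> // : z = 0; apply/matrixP => i.
  by have : (i < 0)%N by rewrite -d0 ltn_ord.
have [[j0 _]|J0] := pselect (exists j : J, True); last first.
  by exists 0, 0 => j; case: J0; exists j.
have /choice[x xK] : forall f : {ffun 'I_d.+1 -> J},
    exists z, forall i, K i (f i) z by move=> f; apply: Kmeet.
(* The hulls keep the transversal property of [K], and unlike the [K i j] they
   are polytopes. *)
pose H i j := hull x (fun f : {ffun 'I_d.+1 -> J} => f i == j).
suff [i [z Hz]] : exists i z, forall j, H i j z.
  exists i, z => j; apply: (hull_subset_convex (Kcvx i j) _ (Hz j)).
  by move=> f /eqP <-.
pose meet (D : {set 'I_d.+1}) (f : 'I_d.+1 -> J) : set V :=
  [set z | forall i, i \in D -> H i (f i) z].
have meet_x D (f : {ffun 'I_d.+1 -> J}) : meet D f (x f).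
  by move=> i _; apply: sub_hull => /=.
have /choice[Bs BsP] : forall q : {set 'I_d.+1} * {ffun 'I_d.+1 -> J},
    exists B : seq V, forall c : 'rV[R]_d, q.1 != finset.set0 ->
    exists b, [/\ b \in B, meet q.1 q.2 b &
      forall z, meet q.1 q.2 z -> dotp c b <= dotp c z].
  move=> [D f] /=; have [D0|[i0 i0D]] := set_0Vmem D.
    by exists [::] => c; rewrite D0 eqxx.
  pose P (a : {i | i \in D}) (g : {ffun 'I_d.+1 -> J}) := g (val a) == f (val a).
  have [B BP] := hulls_min (exist _ i0 i0D : {i | i \in D}) P x.
  have meetP z : meet D f z <-> forall a, hull x (P a) z.
    by split=> [zD [i iD]|zP i iD]; [apply: zD|apply: (zP (exist _ i iD))].
  exists B => c _; have [|b [bB bP bmin]] := BP c.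
    by exists (x f); apply/meetP.
  exists b; split=> //; first exact/meetP.
  by move=> z /meetP; apply: bmin.
pose B := flatten [seq Bs q | q <- enum {: {set 'I_d.+1} * {ffun 'I_d.+1 -> J}}].
have [c c_inj] := separating_functional B.
have /choice[low lowP] : forall q : {set 'I_d.+1} * {ffun 'I_d.+1 -> J},
    exists b, q.1 != finset.set0 -> [/\ b \in B, meet q.1 q.2 b &
      forall z, meet q.1 q.2 z -> dotp c b <= dotp c z].
  move=> q; have [->|q0] := eqVneq q.1 finset.set0; first by exists 0.
  have [b [bB bq bmin]] := BsP q c q0.
  exists b => _; split=> //; apply/flattenP; exists (Bs q) => //.
  by apply/map_f; rewrite mem_enum.
have D1 (k : 'I_d.+1) : ~: [set k]%SET != finset.set0 :> {set 'I_d.+1}.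
  by rewrite -card_gt0 cardsC1 card_ord.
have DT : [set: 'I_d.+1]%SET != finset.set0 :> {set 'I_d.+1}.
  by rewrite -card_gt0 cardsT card_ord.
(* [height (k, f)] is the minimum of [c] on the intersection of the [H i (f i)]
   with [i != k]. *)
pose height (kf : 'I_d.+1 * {ffun 'I_d.+1 -> J}) :=
  dotp c (low (~: [set kf.1]%SET, kf.2)).
have [[k f] _ kf_max] :=
  @arg_maxP _ _ _ (ord0, [ffun=> j0]) xpredT height isT.
pose p := low (~: [set k]%SET, f).
exists k, p => j.
have [pB pmeet pmin] := lowP (~: [set k]%SET, f) (D1 k).
rewrite -/p /= in pB pmeet pmin.
pose g : {ffun 'I_d.+1 -> J} := [ffun i => if i == k then j else f i].
have [qB qmeet qmin] := lowP ([set: 'I_d.+1]%SET, g) DT.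
set q := low _ in qB qmeet qmin; rewrite /= in qB qmeet qmin.
suff -> : p = q by have := qmeet k (finset.in_setT k); rewrite ffunE eqxx.
have pq : dotp c p <= dotp c q.
  apply: pmin => i; rewrite !inE => /negPf ik.
  by have := qmeet i (finset.in_setT i); rewrite ffunE ik.
apply: c_inj => //; apply/eqP; rewrite eq_le pq /= leNgt; apply/negP => p_lt_q.
(* Index 0 is the half-space, the others are the members of the transversal [g].
   Omitting the half-space leaves [x g]; omitting colour [l] leaves a minimizer
   which is at most as high as [p], hence lies in the half-space. *)
pose C (a : 'I_d.+2) : set V :=
  if unlift ord0 a is Some i then H i (g i) else [set z | dotp c z < dotp c q].
have C_cvx a : convex (C a).
  rewrite /C; case: unlift => [i|]; first exact: convex_hull.
  exact: convex_halfspace.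
have C_meet a : exists z, forall b, b != a -> C b z.
  have [l ->|->] := unliftP ord0 a; last first.
    exists (x g) => b; rewrite /C; case: unliftP => [i ->|->]; last by rewrite eqxx.
    by move=> _; apply: (meet_x [set: _]%SET).
  have [rB rmeet rmin] := lowP (~: [set l]%SET, g) (D1 l).
  exists (low (~: [set l]%SET, g)) => b; rewrite /C.
  case: unliftP => [i ->|-> _]; last first.
    by apply: le_lt_trans p_lt_q; apply: (kf_max (l, g)).
  by rewrite (inj_eq lift_inj) => il; apply: rmeet; rewrite !inE.
have [z zC] := helly C_cvx C_meet.
have := zC ord0; rewrite /C unlift_none /= ltNge qmin // => i _.
by have := zC (lift ord0 i); rewrite /C liftK.
Qed.
End ColorfulHelly.

(** * Rational points of pointed semigroups *)

Lemma intr_mx_inj (m n : nat) :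
  injective (fun A : 'M[int]_(m, n) => map_mx intr A : 'M[rat]_(m, n)).
Proof.
move=> A B /matrixP AB; apply/matrixP => i j.
by have := AB i j; rewrite !mxE => /intr_inj.
Qed.

Lemma intr_mxMn (m n : nat) (A : 'M[int]_(m, n)) k :
  map_mx intr (A *+ k) = k%:R *: map_mx intr A :> 'M[rat]_(m, n).
Proof. by apply/matrixP => i j; rewrite !mxE mulmxnE rmorphMn mulr_natl. Qed.

Section RationalPoints.
Variables (d : nat) (S : set 'cV[int]_d).
Hypothesis S0 : S 0.
Hypothesis SD : forall u v, S u -> S v -> S (u + v).

Definition rational_cone : set 'cV[rat]_d :=
  [set x | exists N : nat, exists2 z, S z & N.+1%:R *: x = map_mx intr z].

Lemma submonoidMn u n : S u -> S (u *+ n).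
Proof. by move=> Su; elim: n => // n IHn; rewrite mulrS; apply: SD. Qed.

Lemma rational_cone0 : rational_cone 0.
Proof. by exists 0, 0 => //; rewrite scaler0 map_mx0. Qed.

Lemma rational_coneD x y :
  rational_cone x -> rational_cone y -> rational_cone (x + y).
Proof.
move=> [M [u Su uE]] [N [v Sv vE]].
exists (M.+1 * N.+1).-1, (u *+ N.+1 + v *+ M.+1).
  exact: SD (submonoidMn _ _) (submonoidMn _ _).
rewrite prednK ?muln_gt0 // map_mxD !intr_mxMn -uE -vE natrM scalerDr !scalerA.
by congr (_ *: _ + _); rewrite mulrC.
Qed.

Lemma rational_coneZ (a : rat) x :
  0 <= a -> rational_cone x -> rational_cone (a *: x).
Proof.
move=> a_ge0 [N [z Sz zE]].
have den_gt0 := denq_gt0 a.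
have numE : (numq a)%:~R = `|numq a|%:R :> rat.
  by rewrite pmulrn gez0_abs // numq_ge0.
have denE : (denq a)%:~R = `|denq a|%:R :> rat.
  by rewrite pmulrn gtz0_abs.
have den1 : (0 < `|denq a|)%N by rewrite absz_gt0 gt_eqF.
exists (`|denq a| * N.+1).-1, (z *+ `|numq a|); first exact: submonoidMn.
rewrite prednK ?muln_gt0 ?den1 // intr_mxMn -zE !scalerA natrM.
rewrite -numE -denE -[X in _ * X *: _]divq_num_den; congr (_ *: _).
by rewrite mulrC mulrA divfK ?intr_eq0 ?gt_eqF.
Qed.

Hypothesis Spointed : pointed S.

(** Some positive multiple [w] of [x] is integral with both [w] and [- w] in
[S]. The integral points with this property form a subgroup contained in [S],
which is trivial since [S] is pointed. *)
Lemma rational_cone_pointed x : rational_cone x -> rational_cone (- x) -> x = 0.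
Proof.
move=> [M [u Su uE]] [N [v Sv vE]].
have uv : u *+ N.+1 = - (v *+ M.+1).
  apply: intr_mx_inj.
  rewrite map_mxN !intr_mxMn -uE -vE !scalerN opprK !scalerA.
  by rewrite mulrC.
pose H : {pred 'cV[int]_d} := [pred w | `[< S w /\ S (- w) >]].
have Hzmod : zmod_closed H.
  split=> [|w1 w2]; first by apply/asboolP; rewrite oppr0.
  move=> /asboolP[S1 S1'] /asboolP[S2 S2']; apply/asboolP.
  by split; rewrite ?opprB; apply: SD.
have : [set` H] (u *+ N.+1).
  by apply/asboolP; split; [|rewrite uv opprK]; apply: submonoidMn.
rewrite (Spointed Hzmod); last by move=> w /asboolP[].
move=> /= /(congr1 (fun w => map_mx intr w : 'cV[rat]_d)).
rewrite intr_mxMn map_mx0 -uE scalerA => /eqP.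
by rewrite scaler_eq0 mulf_eq0 !pnatr_eq0 => /eqP.
Qed.

(** If a convex combination vanished, the opposite of a term of nonzero weight
would be the sum of the other terms, hence in the cone. *)
Lemma convex_rational_cone_nonzero : convex [set x | rational_cone x /\ x != 0].
Proof.
move=> I a z a_ge0 sum_a zS.
have az i : rational_cone (a i *: z i).
  have [->|/zS[zi _]] := eqVneq (a i) 0; last exact: rational_coneZ.
  by rewrite scale0r; apply: rational_cone0.
have sumP (P : pred I) : rational_cone (\sum_(i | P i) a i *: z i).
  apply: (big_ind rational_cone) => //; first exact: rational_cone0.
  exact: rational_coneD.
split=> //; apply/eqP => sum0.
suff a0 i : a i = 0 by have := oner_neq0 rat; rewrite -sum_a big1 ?eqxx.
apply/eqP; apply: contraT => ai; have [_ /negP[]] := zS i ai.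
have : a i *: z i = 0.
  apply: rational_cone_pointed => //.
  suff -> : - (a i *: z i) = \sum_(k | k != i) a k *: z k by [].
  by move/eqP: sum0; rewrite (bigD1 i) //= addrC addr_eq0 => /eqP ->.
by move/eqP; rewrite scaler_eq0 (negPf ai).
Qed.
End RationalPoints.

Lemma affine_semigroup_monoid (d : nat) (S : set 'cV[int]_d) :
  affine_semigroup S -> S 0 /\ forall u v, S u -> S v -> S (u + v).
Proof.
move=> [n [A ->]]; split=> [|_ _ [x x0 <-] [y y0 <-]].
  by exists 0; [move=> i; rewrite mxE|rewrite mulmx0].
by exists (x + y); [move=> i; rewrite mxE addr_ge0|rewrite mulmxDr].
Qed.

(** * From semigroups to convex sets *)

Theorem corollary2p7 (d : nat) (hd : (0 < d)%N)
    (F : 'I_d.+1 -> set (set 'cV[int]_d))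
    (hfin : forall i : 'I_d.+1, finite_set (F i))
    (hsg : forall (i : 'I_d.+1) (S : set 'cV[int]_d),
       F i S -> affine_semigroup S /\ pointed S)
    (htrans : forall S : 'I_d.+1 -> set 'cV[int]_d,
       (forall i : 'I_d.+1, F i (S i)) ->
       exists2 x : 'cV[int]_d, x != 0 & (\bigcap_(i in [set: 'I_d.+1]) S i) x) :
  exists j : 'I_d.+1,
    exists2 x : 'cV[int]_d, x != 0 & (\bigcap_(S in F j) S) x.
Proof.
(* The members of an empty family share every vector, and [0 < d] provides a
   nonzero one. *)
have [[i Fi0]|Fnonempty] := pselect (exists i, F i = set0).
  exists i, (const_mx 1); last by rewrite Fi0 => S.
  apply/eqP => /matrixP/(_ (Ordinal hd) 0); rewrite !mxE => /eqP.
  by rewrite oner_eq0.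
have /choice[S0 FS0] : forall i, exists S, F i S.
  by move=> i; apply/set0P/eqP => Fi0; apply: Fnonempty; exists i.
have /choice[s sF] : forall i, exists s : seq (set 'cV[int]_d), F i = [set` s].
  by move=> i; apply/finite_seqP.
(* Each family is listed with the same length [m], repeating [S0 i] at the
   end. *)
pose m := \max_i size (s i).
pose S i (j : 'I_m) := nth (S0 i) (s i) j.
have FS i j : F i (S i j).
  rewrite /S; have [js|js] := ltnP j (size (s i)); last by rewrite nth_default.
  by rewrite sF; apply: mem_nth.
have S_onto i T : F i T -> exists j, S i j = T.
  rewrite sF /= => Ts.
  have Tm : (index T (s i) < m)%N.
    by apply: leq_trans (leq_bigmax i); rewrite index_mem.
  by exists (Ordinal Tm); rewrite /S nth_index.
have [i [x xS]] : exists i x, forall j, rational_cone (S i j) x /\ x != 0.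
  apply: (@colorful_helly rat d _
    (fun i j => [set x | rational_cone (S i j) x /\ x != 0])) => [i j|f].
    have [/affine_semigroup_monoid[S_0 S_D] S_pointed] := hsg _ _ (FS i j).
    exact: convex_rational_cone_nonzero.
  have [x x0 xS] := htrans (fun i => S i (f i)) (fun i => FS i (f i)).
  exists (map_mx intr x) => i; split.
    by exists 0, x; [apply: xS|rewrite scale1r].
  by apply: contra x0 => /eqP x0; apply/eqP/intr_mx_inj; rewrite x0 map_mx0.
(* The common rational point [x], scaled by the product of the denominators
   [N j + 1], is an integral point of all members. *)
have [j0 _] := S_onto i _ (FS0 i).
have /choice[N NP] : forall j, exists N : nat,
    exists2 z, S i j z & N.+1%:R *: x = map_mx intr z.
  by move=> j; have [] := xS j.
have /choice[z zP] : forall j, exists z,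
    S i j z /\ (N j).+1%:R *: x = map_mx intr z.
  by move=> j; have [z] := NP j; exists z.
pose w j := z j *+ \prod_(k | k != j) (N k).+1.
have wE j : map_mx intr (w j) = (\prod_k (N k).+1)%:R *: x.
  rewrite intr_mxMn -(zP j).2 scalerA -natrM mulnC.
  by rewrite [X in _ = X%:R *: _](bigD1 j).
exists i, (w j0) => [|T /S_onto[j <-]].
  apply/eqP => w0; have := wE j0; rewrite w0 map_mx0 => /esym/eqP.
  rewrite scaler_eq0 pnatr_eq0 (negPf (xS j0).2) orbF; apply/negP.
  by rewrite -lt0n prodn_gt0.
have -> : w j0 = w j by apply: intr_mx_inj; rewrite !wE.
have [/affine_semigroup_monoid[S_0 S_D] _] := hsg _ _ (FS i j).
exact: submonoidMn (zP j).1.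
Qed.
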